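(* Let $\vdash_0$ be the proof system consisting of the rules (axiom), (structural), (res), and (rel). Then $\vdash_0$ is sound and complete for $\mathcal{L}_4^+$; that is, for every theory $\Gamma$ and every sentence $\varphi$ of $\mathcal{L}_4^+$, $\Gamma\vdash_0\varphi$ if and only if $\Gamma\models\varphi$.
   Context: Syntax of $\mathcal{L}_4^+$. Fix a set $P$ of nouns and a set $R$ of verbs. Terms: every noun is a term; if $x$ is a term and $r\in R$ then $(r\ \mathsf{all}\ x)$ and $\overline{x}$ are terms. Sentences: $[x_1,\dots,x_n]$ for all $n\ge1$ and terms $x_1,\dots,x_n$. A theory is a set of sentences. Semantics. A model $\mathcal{M}$ is a set $M$ (possibly empty) with $[\![p]\!]\subseteq M$ for $p\in P$ and $[\![r]\!]\subseteq M\times M$ for $r\in R$; $[\![r\ \mathsf{all}\ x]\!]=\{m\in M: m\,[\![r]\!]\,n\text{ for all }n\in[\![x]\!]\}$; $[\![\overline{x}]\!]=M\setminus[\![x]\!]$. $\mathcal{M}\models[x_1,\dots,x_n]$ iff $\bigcap_{i=1}^n[\![x_i]\!]=\emptyset$. $\Gamma\models\varphi$ means every model of $\Gamma$ satisfies $\varphi$. Rules: (axiom) infer $[x,\overline{x}]$ from no premises; (structural) from $[x_1,\dots,x_m]$ infer $[y_1,\dots,y_n]$, provided each $x_i$ is identical to some $y_j$; (res) from $[x,y_1,\dots,y_n]$ and $[\overline{x},z_1,\dots,z_m]$ infer $[y_1,\dots,y_n,z_1,\dots,z_m]$ ($n$ or $m$ may be $0$ as long as the conclusion is a nonempty list); (rel)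 from $[\overline{x_1},\dots,\overline{x_{n-1}},x_n]$ infer $[(r\ \mathsf{all}\ x_1),\dots,(r\ \mathsf{all}\ x_{n-1}),\overline{(r\ \mathsf{all}\ x_n)}]$ ($n\ge1$). $\Gamma\vdash_0\varphi$ means there is a finite proof tree with root $\varphi$ in which each node is a leaf in $\Gamma$ or the conclusion, with its children the premises, of an instance of a rule. *)

(* Defs.v *)
From Stdlib Require Import List.
Import ListNotations.

Set Implicit Arguments.

Inductive term (P R : Type) : Type :=
| Noun : P -> term P R
| All : R -> term P R -> term P R
| Compl : term P R -> term P R.

Arguments Noun {P R} _.
Arguments All {P R} _ _.
Arguments Compl {P R} _.

(* A nonempty list of terms, as a head and a tail, so that equality of
   sentences is equality of the underlying lists. *)
Record sentence (P R : Type) : Type := Sentence {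
  first : term P R;
  rest : list (term P R)
}.

Definition terms (P R : Type) (s : sentence P R) : list (term P R) :=
  first s :: rest s.

Definition theory (P R : Type) : Type := sentence P R -> Prop.

Record model (P R : Type) : Type := Model {
  carrier : Type; (* possibly empty *)
  noun : P -> carrier -> Prop;
  verb : R -> carrier -> carrier -> Prop
}.

Fixpoint interp (P R : Type) (M : model P R) (x : term P R) : carrier M -> Prop :=
  match x with
  | Noun p => noun M p
  | All r y => fun m => forall n, interp M y n -> verb M r m n
  | Compl y => fun m => ~ interp M y m
  end.

Definition satisfies (P R : Type) (M : model P R) (s : sentence P R) : Prop :=
  ~ exists m : carrier M, forall x, In x (terms s) -> interp M x m.

Definition entails (P R : Type) (G : theory P R) (s : sentence P R) : Prop :=
  forall M : model P R, (forall g, G g -> satisfies M g) -> satisfies M s.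

(* Premises and conclusions range over [sentence], so the equations on [terms]
   restrict every rule to instances whose sentences are nonempty lists; this
   matters for [derives_res], where [ys ++ zs] may be empty. *)
Inductive derives (P R : Type) (G : theory P R) : sentence P R -> Prop :=
| derives_premise : forall s, G s -> derives G s
| derives_axiom : forall x s,
    terms s = [x; Compl x] -> derives G s
| derives_structural : forall s t,
    (forall x, In x (terms s) -> In x (terms t)) ->
    derives G s -> derives G t
| derives_res : forall x ys zs s t u,
    terms s = x :: ys ->
    terms t = Compl x :: zs ->
    terms u = ys ++ zs ->
    derives G s -> derives G t -> derives G u
| derives_rel : forall r xs x s t,
    terms s = map Compl xs ++ [x] ->
    terms t = map (All r) xs ++ [Compl (All r x)] ->
    derives G s -> derives G t.

(* Main.v *)
Require Import Defs.
From Stdlib Require Import List Classical.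
From mathcomp Require Import classical_sets.
Import ListNotations.

Set Implicit Arguments.
#[local] Set Bullet Behavior "Strict Subproofs".

(** Soundness is a direct check of each rule ([derives_sound]).  Completeness
    is a canonical-model argument.  Fix a theory [G].  A set of terms is
    consistent when no sentence built from its members is derivable.  If [s]
    is not derivable then the set of its terms is consistent, by (structural),
    and Zorn's lemma extends it to a maximal consistent set
    ([consistent_extends]).  When some sentence is underivable, a maximal
    consistent set contains exactly one of [x] and [Compl x], by (axiom) and
    (res) ([maximal_compl]).

    The canonical model has the maximal consistent sets as its points.  A noun
    holds at the sets that contain it, and [S] is [r]-related to [T] when some
    [All r x] in [S] has [x] in [T].  The truth lemma ([truth]) says that a
    term holds at exactly the points that contain it.  Its one interesting
    case is a point [S] without [All r x]: a point [T] is needed that contains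
    [x] and is not [r]-related to [S], that is, which extends [x] together
    with all [Compl y] for [All r y] in [S].  This set is consistent, since
    (rel) turns a derivable sentence over it into a derivable sentence over
    [S] ([successor_consistent]).  By the truth lemma the canonical model
    satisfies [G] but not [s]. *)

(** A finite list drawn from [x] and the image of [D] under [f] involves [x]
    and the images of finitely many members of [D]. *)
Lemma list_in_image (A B : Type) (D : A -> Prop) (f : A -> B) (x : B)
    (l : list B) :
  (forall z, In z l -> z = x \/ exists2 y, D y & z = f y) ->
  exists2 ys, forall y, In y ys -> D y
            & forall z, In z l -> In z (x :: map f ys).
Proof.
induction l as [|a l IH]; intros Hl; [exists nil; intros ? []|].
destruct IH as [ys Hys Hsub]; [intros z Hz; apply Hl; simpl; auto|].
destruct (Hl a (or_introl eq_refl)) as [->|[y Dy ->]].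
- exists ys; auto; intros z [<-|Hz]; [left|apply Hsub]; auto.
- exists (y :: ys); [intros z [<-|Hz]; auto|].
  intros z [<-|Hz]; simpl; auto.
  destruct (Hsub z Hz); auto.
Qed.

Section Derivations.
Variables (P R : Type) (G : theory P R).
Implicit Types (x y : term P R) (s t : sentence P R)
  (S T : set (term P R)).

Lemma derives_sound s : derives G s -> entails G s.
Proof.
intros D M HM; induction D as [s Hs|x s E|s t Hst _ IH
  |x ys zs s t u Es Et Eu _ IHs _ IHt|r xs x s t Es Et _ IH].
- exact (HM s Hs).
- intros [m Hm]; rewrite E in Hm.
  apply (Hm (Compl x)); [|apply Hm]; simpl; auto.
- intros [m Hm]; apply IH; exists m; auto.
- intros [m Hm]; rewrite Eu in Hm.
  destruct (classic (interp M x m)) as [Hx|Hx].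
  + apply IHs; exists m; rewrite Es; intros y [<-|Hy]; auto.
    apply Hm, in_or_app; auto.
  + apply IHt; exists m; rewrite Et; intros y [<-|Hy]; auto.
    apply Hm, in_or_app; auto.
- intros [m Hm]; rewrite Et in Hm.
  apply (Hm (Compl (All r x))); [apply in_or_app; simpl; auto|].
  intros n Hn; apply NNPP; intros Hr.
  apply IH; exists n; rewrite Es; intros y Hy.
  apply in_app_or in Hy as [Hy|[<-|[]]]; auto.
  apply in_map_iff in Hy as [z [<- Hz]]; intros Hzn; apply Hr.
  refine (Hm (All r z) _ n Hzn).
  apply in_or_app; left; apply in_map; exact Hz.
Qed.

(** No sentence whose terms all belong to [S] is derivable from [G]. *)
Definition consistent S : Prop :=
  forall t, (forall x, In x (terms t) -> S x) -> ~ derives G t.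

(** A consistent set that contains every consistent set extending it. *)
Definition maximal S : Prop :=
  consistent S /\ forall T, consistent T -> (forall x, S x -> T x) ->
                  forall x, T x -> S x.

(** A list over the union of [S] and a chain [F] lies over [S] and one member
    of [F]; the first alternative is needed only when [F] is empty. *)
Lemma list_in_chain S (F : set (set (term P R))) (l : list (term P R)) :
  total_on F subset ->
  (forall x, In x l -> S x \/ exists2 X, F X & X x) ->
  (forall x, In x l -> S x) \/
  exists2 X, F X & forall x, In x l -> S x \/ X x.
Proof.
intros Ftot; induction l as [|a l IH]; intros Hl; [left; intros x []|].
destruct IH as [IH|[X FX IH]]; [intros x Hx; apply Hl; simpl; auto| |];
  destruct (Hl a (or_introl eq_refl)) as [Ha|[Y FY Ya]].
- left; intros x [<-|Hx]; auto.
- right; exists Y; auto; intros x [<-|Hx]; auto.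
- right; exists X; auto; intros x [<-|Hx]; auto.
- right; destruct (Ftot X Y FX FY) as [XY|YX].
  + exists Y; auto; intros x [<-|Hx]; auto.
    destruct (IH x Hx); auto.
  + exists X; auto; intros x [<-|Hx]; auto.
Qed.

Lemma consistent_extends S :
  consistent S -> exists2 T, maximal T & forall x, S x -> T x.
Proof.
intros HS.
(* Zorn's lemma also ranges over the empty chain, whose union is empty; hence
   it is applied to the sets whose union with [S] is consistent. *)
destruct (@Zorn_bigcup _ (fun X => consistent (fun x => S x \/ X x)))
  as [A [HA Amax]].
- intros F HF Ftot t Ht.
  destruct (@list_in_chain S F (terms t) Ftot Ht) as [H|[X FX H]].
  + exact (HS t H).
  + exact (HF X FX t H).
- exists (fun x => S x \/ A x); auto.
  split; auto; intros T HT ST x Tx; right; apply NNPP; intros Ax.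
  apply (Amax T).
  + split; [intros y Hy; auto|intros TA; apply Ax, TA, Tx].
  + intros t Ht; apply HT; intros y Hy; destruct (Ht y Hy); auto.
Qed.

Lemma terms_rcons (l : list (term P R)) x :
  exists t, terms t = l ++ [x].
Proof.
destruct l as [|a l]; [exists (Sentence x nil)|exists (Sentence a (l ++ [x]))];
  reflexivity.
Qed.

Lemma maximal_not_in S x :
  maximal S -> ~ S x ->
  exists2 ys, forall y, In y ys -> S y & derives G (Sentence x ys).
Proof.
intros [_ Smax] Sx; apply NNPP; intros H; apply Sx.
apply (Smax (fun z => z = x \/ S z)); auto.
intros t Ht Dt; apply H.
destruct (@list_in_image _ _ S (fun y => y) x (terms t)) as [ys Hys Hsub].
- intros z Hz; destruct (Ht z Hz); eauto.
- exists ys; auto; rewrite map_id in Hsub.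
  exact (@derives_structural _ _ G t (Sentence x ys) Hsub Dt).
Qed.

(** The underivable sentence is needed because the resolvent of [[x]] and
    [[Compl x]] would be the empty list, which is not a sentence. *)
Lemma maximal_compl s S x :
  ~ derives G s -> maximal S -> (S (Compl x) <-> ~ S x).
Proof.
intros Ds HS; split.
- intros Sc Sx; apply (proj1 HS (Sentence x [Compl x])).
  + intros y [<-|[<-|[]]]; auto.
  + apply derives_axiom with x; reflexivity.
- intros Sx; apply NNPP; intros Sc.
  destruct (maximal_not_in x HS Sx) as [ys Hys Dys].
  destruct (maximal_not_in (Compl x) HS Sc) as [zs Hzs Dzs].
  assert (Hin : forall y, In y (ys ++ zs) -> S y).
  { intros y Hy; apply in_app_or in Hy as [Hy|Hy]; auto. }
  destruct (ys ++ zs) as [|a l] eqn:E.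
  + apply app_eq_nil in E as [-> ->]; apply Ds.
    (* Weakening [[x]] by the terms of [s] makes the resolvent [s] itself. *)
    apply derives_res with (x := x) (ys := terms s) (zs := nil)
      (s := Sentence x (terms s)) (t := Sentence (Compl x) nil); auto.
    * rewrite app_nil_r; reflexivity.
    * apply (@derives_structural _ _ G (Sentence x nil)); auto.
      intros y [<-|[]]; simpl; auto.
  + apply (proj1 HS (Sentence a l)); auto.
    apply (@derives_res _ _ G x ys zs (Sentence x ys) (Sentence (Compl x) zs));
      auto.
Qed.

Lemma successor_consistent S r x :
  consistent S -> S (Compl (All r x)) ->
  consistent (fun z => z = x \/ exists2 y, S (All r y) & z = Compl y).
Proof.
intros HS Sx t Ht Dt.
destruct (list_in_image _ (@Compl P R) (terms t) Ht) as [ys Hys Hsub].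
destruct (terms_rcons (map Compl ys) x) as [p Ep].
destruct (terms_rcons (map (All r) ys) (Compl (All r x))) as [q Eq].
apply (HS q).
- rewrite Eq; intros z Hz; apply in_app_or in Hz as [Hz|[<-|[]]]; auto.
  apply in_map_iff in Hz as [y [<- Hy]]; auto.
- apply (derives_rel r ys x Ep Eq).
  apply derives_structural with t; auto.
  rewrite Ep; intros z Hz; apply in_or_app.
  destruct (Hsub z Hz); simpl; auto.
Qed.

(** The model on the maximal consistent sets.  Its verbs are as small as the
    truth lemma permits: [m] is [r]-related to [n] only when some [All r x] in
    [m] with [x] in [n] requires it. *)
Definition canonical : model P R :=
  @Model P R {S : set (term P R) | maximal S}
    (fun p m => proj1_sig m (Noun p))
    (fun r m n => exists2 x, proj1_sig m (All r x) & proj1_sig n x).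

Lemma truth s : ~ derives G s ->
  forall x (S : carrier canonical), interp canonical x S <-> proj1_sig S x.
Proof.
intros Ds x; induction x as [p|r x IH|x IH]; intros S.
- reflexivity.
- split; [|intros Sx T Tx; exists x; [exact Sx|apply IH, Tx]].
  intros H; apply NNPP; intros Sx.
  destruct S as [S HS]; simpl in *.
  apply (maximal_compl (All r x) Ds HS) in Sx.
  destruct (consistent_extends (@successor_consistent S r x (proj1 HS) Sx))
    as [T HT sub].
  destruct (H (exist _ T HT)) as [y Sy Ty].
  + apply IH; simpl; auto.
  + apply (maximal_compl y Ds HT); simpl; eauto.
- simpl; rewrite IH; symmetry.
  exact (maximal_compl x Ds (proj2_sig S)).
Qed.

Lemma derives_complete s : entails G s -> derives G s.
Proof.
intros Hs; apply NNPP; intros Ds.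
apply (Hs canonical).
- intros g Gg [S HS]; apply (proj1 (proj2_sig S) g).
  + intros x Hx; apply (truth Ds), HS, Hx.
  + apply derives_premise, Gg.
- destruct (@consistent_extends (fun x => In x (terms s))) as [S HS sub].
  + intros t Ht Dt; apply Ds; exact (derives_structural Ht Dt).
  + exists (exist _ S HS); intros x Hx; apply (truth Ds), sub, Hx.
Qed.

End Derivations.

Theorem corollary4p12 (P R : Type) (G : theory P R) (s : sentence P R) :
  derives G s <-> entails G s.
Proof.
split; [apply derives_sound|apply derives_complete].
Qed.
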